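(* Let $\kappa$ be inaccessible and let $b:\kappa\to\kappa$ be an increasing function such that each $b(\alpha)$ is an infinite cardinal. If $\lambda<\kappa$ is a regular cardinal and $\mathrm{cf}(b(\alpha))=\lambda$ for cofinally many $\alpha\in\kappa$, then $\mathfrak d_\kappa^b(\leq^* )=2^\kappa$.
   Context: ''Increasing'' means not necessarily strictly increasing. $\prod b$ is the set of functions $f$ with domain $\kappa$ and $f(\alpha)\in b(\alpha)$ for all $\alpha\in\kappa$. $f\leq^*g$ means that there is $\beta<\kappa$ with $f(\alpha)\leq g(\alpha)$ for all $\alpha>\beta$. ''Cofinally many'' means unboundedly many in $\kappa$. The dominating number $\mathfrak d_\kappa^b(\leq^* )$ is the least size of a set $D\subseteq\prod b$ such that for every $f\in\prod b$ there is $g\in D$ with $f\leq^*g$. *)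

(* Defs.v *)
From mathcomp Require Import all_boot all_order all_classical.
From mathcomp Require wochoice.

Set Implicit Arguments.
Unset Strict Implicit.
Unset Printing Implicit Defensive.

Local Open Scope classical_set_scope.
Local Open Scope card_scope.
Local Open Scope order_scope.

(* The ordinal kappa is represented by a well-ordered type [K] of that order
   type: the elements of [K] are the ordinals below kappa. As in von Neumann's
   encoding, an ordinal is the set of its predecessors, so [a : K] stands for
   the initial segment [below a] and kappa itself for [[set: K]]. The notions
   below take the initial segment as argument, hence apply to both. *)

Definition below d (K : orderType d) (a : K) : set K := [set x | x < a].

(* A cardinal is an ordinal not equinumerous with any smaller ordinal. *)
Definition is_cardinal d (K : orderType d) (A : set K) : Prop :=
  forall x, A x -> ~ (below x #= A).

Definition is_infinite_cardinal d (K : orderType d) (A : set K) : Prop :=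
  is_cardinal A /\ infinite_set A.

(* The least size of a member of the family [F] is the cardinality of [C]. *)
Definition least_size T U (F : set (set T)) (C : set U) : Prop :=
  (exists2 D, F D & D #= C) /\ (forall D, F D -> C #<= D).

Definition cofinal_in d (K : orderType d) (A C : set K) : Prop :=
  C `<=` A /\ forall x, A x -> exists2 y, C y & x <= y.

(* cf(A) = L; used only when [L] is a cardinal, so that comparing sizes
   determines it. *)
Definition cofinality_is d (K : orderType d) (A L : set K) : Prop :=
  least_size (cofinal_in A) L.

Definition is_regular d (K : orderType d) (A : set K) : Prop :=
  is_infinite_cardinal A /\ cofinality_is A A.

(* 2^A, as the power set of A *)
Definition power_set T (A : set T) : set (set T) := [set X | X `<=` A].

Definition card_lt T U (A : set T) (B : set U) : Prop :=
  A #<= B /\ ~ (A #= B).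

Definition inaccessible d (K : orderType d) : Prop :=
  [/\ wochoice.well_order (<=%O : rel K),
      ~ countable [set: K],
      is_regular [set: K] &
      forall m : K, is_cardinal (below m) ->
        card_lt (power_set (below m)) [set: K]].

Definition bounded_prod d (K : orderType d) (b : K -> K) : set (K -> K) :=
  [set f | forall a : K, f a < b a].

Definition le_star d (K : orderType d) (f g : K -> K) : Prop :=
  exists beta : K, forall a : K, beta < a -> f a <= g a.

Definition dominating d (K : orderType d) (b : K -> K)
    (D : set (K -> K)) : Prop :=
  D `<=` bounded_prod b /\
  forall f, bounded_prod b f -> exists2 g, D g & le_star f g.

Definition dominating_number_is d (K : orderType d) (b : K -> K)
    U (C : set U) : Prop :=
  least_size (@dominating d K b) C.

(* Main.v *)
(* Call a set small when it injects into a proper initial segment of kappa.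
   Write l for lambda and let S be the set of those a with cf(b(a)) = l. The
   pairs (c, G) with c < kappa and G a set of pairs of a subset of c and an
   ordinal below l number at most kappa = |S|, so each can be attached to its
   own point of S. If (c, G) is attached to a, let f_X(a) be the i-th term of a
   cofinal l-sequence in b(a), where i is the index that G assigns to the
   trace of X on c.
   Given l distinct sets X_i, their traces on c all differ for large c, so there
   are unboundedly many a at which f_{X_i}(a) is the i-th term for every i < l:
   no g in prod b dominates l many of the f_X.

   If D is dominating, the 2^kappa many X are therefore covered by l many
   pieces on which a map to D is injective. Identifying sets X with l-sequences
   of sets, Koenig's diagonal argument shows that the i-th coordinate maps one
   of these pieces onto the whole power set, whence 2^kappa <= |D|. *)
Require Import Defs.
From mathcomp Require Import all_boot all_order all_classical.

Set Implicit Arguments.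
Unset Strict Implicit.
Unset Printing Implicit Defensive.

Import Order.TTheory.

Local Open Scope classical_set_scope.
Local Open Scope card_scope.
Local Open Scope order_scope.

(** * Comparing cardinalities by total functions injective on a set *)

Lemma card_le_inj_on T U (A : set T) (B : set U) (u0 : U) :
  A #<= B ->
  exists2 f : T -> U, forall x, A x -> B (f x) &
    forall x y, A x -> A y -> f x = f y -> x = y.
Proof.
move=> /card_leP[g].
pose f x := if pselect (A x) is left h then val (g (SigSub (mem_set h)))
  else u0.
exists f => [x Ax|x y Ax Ay]; rewrite /f.
  by case: pselect => // h; apply/set_mem/valP.
case: pselect => // hx; case: pselect => // hy /val_inj.
by move=> /(@inj _ _ _ g); rewrite !inE => /(_ I I)/(congr1 val).
Qed.

Lemma inj_on_card_le T U (A : set T) (B : set U) (f : T -> U) :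
  (forall x, A x -> B (f x)) ->
  (forall x y, A x -> A y -> f x = f y -> x = y) -> A #<= B.
Proof.
move=> fAB finj.
have sub : f @` A `<=` B by move=> _ [x Ax <-]; exact: fAB.
apply: card_le_trans (subset_card_le sub).
have E : f @` A #= A.
  by apply: inj_card_eq => x y /set_mem Ax /set_mem; exact: finj.
by have /card_eqPle[] := E.
Qed.

Lemma power_set_card_le T U (A : set T) (B : set U) (u0 : U) :
  A #<= B -> power_set A #<= power_set B.
Proof.
move=> /(card_le_inj_on u0)[f fB finj].
apply: (@inj_on_card_le _ _ _ _ (fun X => f @` X)).
  by move=> X XA _ [x Xx <-]; exact/fB/XA.
suff sub X Y : X `<=` A -> Y `<=` A -> f @` X = f @` Y -> X `<=` Y.
  by move=> X Y XA YA E; apply/seteqP; split; apply: sub.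
move=> XA YA E x Xx; have : (f @` Y) (f x) by rewrite -E; exists x.
by move=> [y Yy fyx]; rewrite -(finj y x) //; [exact: YA|exact: XA].
Qed.

Lemma kuratowski_inj T (a b c d : T) :
  [set [set a]; [set a; b]] = [set [set c]; [set c; d]] -> (a, b) = (c, d).
Proof.
move=> E.
have ac : c = a.
  have : [set [set c]; [set c; d]] [set a] by rewrite -E; left.
  by case=> /seteqP[_]; apply; [|left].
rewrite ac in E *; congr pair.
have db : [set a; b] d.
  have : [set [set a]; [set a; b]] [set a; d] by rewrite E; right.
  by case=> /seteqP[+ _] => /(_ d (or_intror erefl)); [left|].
have bd : [set a; d] b.
  have : [set [set a]; [set a; d]] [set a; b] by rewrite -E; right.
  by case=> /seteqP[+ _] => /(_ b (or_intror erefl)); [left|].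
by case: db => [|->//]; case: bd => [->|->].
Qed.

(** * Small sets: regularity and closure properties *)

Section Inaccessible.
Context d (K : orderType d).
Hypothesis hK : inaccessible K.

Definition small T (A : set T) := exists m : K, A #<= below m.

Lemma inaccessible_point : exists o : K, True.
Proof.
case: hK => _ nc _ _; apply: contrapT => no; apply: nc.
suff -> : [set: K] = set0 by exact: countable0.
by rewrite -subset0 => x _; apply: no; exists x.
Qed.

Lemma exists_least (P : set K) :
  P !=set0 -> exists2 z, P z & forall x, P x -> z <= x.
Proof.
case: hK => wo _ _ _ [x Px].
have [|z [[zP zmin] _]] := wo (mem P); first by exists x; rewrite inE.
exists z; first by move: zP; rewrite inE.
by move=> y Py; apply: zmin; rewrite inE.
Qed.

Lemma inaccessible_wf : well_founded (fun x y : K => x < y).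
Proof.
move=> x; apply: contrapT => nx.
have [z nz zmin] := @exists_least [set y | ~ Acc (fun x y : K => x < y) y]
  (ex_intro _ x nx).
apply: nz; constructor => y yz; apply: contrapT => /zmin.
by rewrite leNgt yz.
Qed.

Lemma not_card_le_below (m : K) : ~ ([set: K] #<= below m).
Proof.
case: hK => _ _ [[Kcard _] _] _ le; apply: (Kcard m I).
by apply/card_eqPle; split; [exact: card_leT|].
Qed.

Lemma unbounded_card_ge (C : set K) :
  (forall x, exists2 y, C y & x <= y) -> [set: K] #<= C.
Proof.
by case: hK => _ _ [_ [_ +]] _ Cunb; apply; split => // x _; exact: Cunb.
Qed.

Lemma card_lt_bounded (C : set K) :
  ~ ([set: K] #<= C) -> exists x, forall y, C y -> y < x.
Proof.
move=> nC; apply: contrapT => nb; apply/nC/unbounded_card_ge => x.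
apply: contrapT => nx; apply: nb; exists x => y Cy.
by rewrite ltNge; apply/negP => xy; apply: nx; exists y.
Qed.

Lemma small_not_card_ge T (A : set T) : small A -> ~ ([set: K] #<= A).
Proof. by move=> [m Am] /card_le_trans/(_ Am); exact: not_card_le_below. Qed.

Lemma card_lt_small T (A : set T) :
  A #<= [set: K] -> ~ ([set: K] #<= A) -> small A.
Proof.
have [o _] := inaccessible_point.
move=> /(card_le_inj_on o)[f _ finj] nA.
have [|m mP] := @card_lt_bounded (f @` A).
  by move=> le; apply: nA; apply: card_le_trans le (card_image_le _ _).
exists m; apply: (@inj_on_card_le _ _ _ _ f) => // x Ax.
by apply: mP; exists x.
Qed.

Lemma card_le_small T U (A : set T) (B : set U) :
  A #<= B -> small B -> small A.
Proof. by move=> AB [m Bm]; exists m; exact: card_le_trans Bm. Qed.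

(** This is the form in which regularity is used: a small image cannot be cofinal in kappa. *)
Lemma small_family_bounded T (A : set T) (f : T -> K) :
  small A -> exists x, forall t, A t -> f t < x.
Proof.
move=> /(card_le_small (card_image_le f A))/small_not_card_ge.
by move=> /card_lt_bounded[x xP]; exists x => t At; apply: xP; exists t.
Qed.

Lemma small_below (m : K) : small (below m).
Proof. by exists m; exact: card_lexx. Qed.

Lemma inaccessible_no_max (x : K) : exists y, x < y.
Proof.
have [|y /(_ x erefl)] := @card_lt_bounded [set x]; last by exists y.
case: hK => _ _ [[_ Kinf] _] _ /card_le_finite/(_ (finite_set1 x)).
exact: Kinf.
Qed.

Lemma small_power_set T (A : set T) : small A -> small (power_set A).
Proof.
have [o _] := inaccessible_point.
move=> [m Am].
(* The strong limit hypothesis speaks of cardinals only, so [m] is replaced by the least [c] of at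
   least its size. *)
have [|c cm cmin] := @exists_least [set c | below m #<= below c].
  by exists m; exact: card_lexx.
have c_card : is_cardinal (below c).
  move=> x; rewrite /below/= => xc /card_eqPle[_ cx].
  by have := cmin x (card_le_trans cm cx); rewrite leNgt xc.
apply: card_le_small (power_set_card_le o (card_le_trans Am cm)) _.
case: hK => _ _ _ /(_ c c_card)[le ne].
by apply: card_lt_small => // ge; apply: ne; apply/card_eqPle.
Qed.

Lemma small_setM T U (A : set T) (B : set U) :
  small A -> small B -> small (A `*` B).
Proof.
have [o _] := inaccessible_point.
move=> [m /(card_le_inj_on o)[f fm finj]] [n /(card_le_inj_on o)[g gn ginj]].
(* Kuratowski pairs avoid any cardinal arithmetic. *)
apply: card_le_small
  (small_power_set (small_power_set (small_below (Order.max m n)))).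
apply: (@inj_on_card_le _ _ _ _
  (fun p => [set [set f p.1]; [set f p.1; g p.2]])).
  move=> [x y] [/= Ax By].
  have fx : below (Order.max m n) (f x).
    by rewrite /below/= lt_max [f x < m]fm.
  have gy : below (Order.max m n) (g y).
    by rewrite /below/= lt_max [g y < n]gn ?orbT.
  by move=> X [] -> z /=; [move=> ->|case=> ->].
move=> [x y] [x' y'] [/= Ax By] [/= Ax' By'] /= E.
have [] := kuratowski_inj E; by move=> /finj-> // /ginj->.
Qed.

(** * Well-founded recursion, and counting sets with small fibres *)

Lemma wf_recursion U (F : K -> (K -> U) -> U) (u0 : U) :
  exists M : K -> U,
    forall c, M c = F c (fun a => if a < c then M a else u0).
Proof.
(* Padding with [u0] from [c] on lets [F] take a total function, free of proof arguments. *)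
pose G c (rec : forall a, a < c -> U) :=
  F c (fun a => if pselect (a < c) is left h then rec a h else u0).
exists (Fix inaccessible_wf (fun=> U) G) => c.
rewrite Fix_eq => [|x f g fg]; last first.
  by rewrite /G; congr F; apply/funext => a; case: pselect.
rewrite /G; congr F; apply/funext => a.
by case: pselect => [->|/negP/negbTE->].
Qed.

(** Elements of [A] not yet used are picked by recursion: either this succeeds at all stages below
    [l], or [A] is exhausted at some stage before [l]. *)
Lemma card_le_total_below T (A : set T) (l : K) :
  below l #<= A \/ A #<= below l.
Proof.
have [->|/set0P[t0 At0]] := eqVneq A set0; first by right; exact: card_ge0.
have /choice[pick pickP] : forall B : set T, exists t, B !=set0 -> B t.
  move=> B; have [[t Bt]|nB] := pselect (B !=set0); first by exists t.
  by exists t0.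
have [x xE] := @wf_recursion T (fun i phi => pick (A `\` phi @` below i)) t0.
have {}xE i : x i = pick (A `\` x @` below i).
  rewrite xE; congr (pick (A `\` _)); apply/seteqP.
  by split=> _ [j ji <-]; exists j => //; rewrite [j < i]ji.
have [xP|/existsNP[i /not_implyP[il nx]]] :=
  pselect (forall i, below l i -> A `\` x @` below i !=set0).
  left; have xA i : below l i -> (A `\` x @` below i) (x i).
    by move=> il; rewrite [X in _ X]xE; apply: pickP; exact: xP.
  have xne i j : below l j -> i < j -> x i <> x j.
    by move=> /xA[_ nj] ij E; apply: nj; exists i.
  apply: (@inj_on_card_le _ _ _ _ x) => [i /xA[]//|i j il jl E].
  by case: (ltgtP i j) => // /xne h; exfalso; [apply: (h jl)|apply: (h il)].
right; have sub : A `<=` x @` below i.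
  by move=> t At; apply: contrapT => nt; apply: nx; exists t.
apply: card_le_trans (subset_card_le sub) _.
apply: card_le_trans (card_image_le _ _) (subset_card_le _).
by move=> j ji; exact: lt_trans ji il.
Qed.

Lemma card_le_above (x : K) : [set: K] #<= [set y | x < y].
Proof.
apply: unbounded_card_ge => z.
have [y] := inaccessible_no_max (Order.max x z).
by rewrite gt_max => /andP[xy /ltW zy]; exists y.
Qed.

(* The fibre over [c] is mapped into the interval between [M c] and
   [u (M c, c)], and [M] is chosen so that these intervals are disjoint. *)
Lemma fibred_card_le T (A : set T) (r : T -> K) :
  (forall c, small [set t | A t /\ r t = c]) -> A #<= [set: K].
Proof.
have [o _] := inaccessible_point.
move=> /choice[m mP].
have /choice[i iP] : forall c, exists i : T -> K,
    (forall t, A t -> r t = c -> i t < m c) /\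
    forall s t, A s -> A t -> r s = c -> r t = c -> i s = i t -> s = t.
  move=> c; have [i im iinj] := card_le_inj_on o (mP c); exists i.
  by split=> [t At rt|s t As At rs rt]; [exact: im|exact: iinj].
have /choice[j jP] : forall x, exists j : K -> K,
    (forall y, x < j y) /\ injective j.
  move=> x; have [j jx jinj] := card_le_inj_on o (card_le_above x).
  by exists j; split=> [y|y z]; [exact: jx|exact: jinj].
have /choice[u uP] : forall p : K * K, exists u, forall y, y < m p.2 ->
    j p.1 y < u.
  by move=> p; apply: small_family_bounded; exact: small_below.
have /choice[bnd bndP] : forall p : K * (K -> K), exists x, forall a, a < p.1 ->
    u (p.2 a, a) < x.
  move=> p; apply: (@small_family_bounded _ _ (fun a => u (p.2 a, a))).
  exact: small_below.
have [M ME] := @wf_recursion K (fun c phi => bnd (c, phi)) o.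
have uM a c : a < c -> u (M a, a) < M c.
  move=> ac; rewrite [M c]ME.
  by have := bndP (c, fun a => if a < c then M a else o) a ac; rewrite /= ac.
pose e t := j (M (r t)) (i (r t) t).
have e_lt s t : A s -> r s < r t -> e s < e t.
  move=> As st; apply: lt_trans ((jP (M (r t))).1 _).
  by apply: lt_trans (uM _ _ st); apply: (uP (_, _)); apply: (iP _).1.
apply: (@inj_on_card_le _ _ _ _ e) => // s t As At.
case: (ltgtP (r s) (r t)) => [st|ts|st] E.
- by have := e_lt _ _ As st; rewrite E ltxx.
- by have := e_lt _ _ At ts; rewrite E ltxx.
- move: E; rewrite /e st => /(jP _).2; exact: (iP (r t)).2.
Qed.

Lemma small_le (c : K) : small [set x | x <= c].
Proof.
have [y cy] := inaccessible_no_max c.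
apply: card_le_small (small_below y); apply: subset_card_le => x xc.
exact: le_lt_trans cy.
Qed.

Lemma card_le_setMKK : [set: K * K] #<= [set: K].
Proof.
(* Pairs with maximum [c] lie in a product of two small sets. *)
apply: (@fibred_card_le _ _ (fun p => Order.max p.1 p.2)) => c.
apply: card_le_small (small_setM (small_le c) (small_le c)).
apply: subset_card_le => -[x y] [_ /= <-].
by split; rewrite /= le_max lexx ?orbT.
Qed.

(** * Functions in the product of which fewer than lambda share a bound *)

Section IndependentFamily.
Variables (b : K -> K) (l : K).
Hypothesis b_neq0 : forall a, below (b a) !=set0.
Hypothesis l_infinite : infinite_set (below l).
Let S := [set a | cofinality_is (below (b a)) (below l)].
Hypothesis S_cofinal : forall x, exists2 y, S y & x <= y.

Lemma exists_cofinal_map (a : K) : S a ->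
  exists k : K -> K, (forall i, k i < b a) /\
    forall x, x < b a -> exists2 i, i < l & x < k i.
Proof.
move=> [[C [Cb Ccof] Cl] lmin].
have [o ob] := b_neq0 a.
(* Strictness comes from [l] being infinite: were no element of [C] above [x], the singleton of [x]
   would be cofinal in [b a]. *)
have Cn x : x < b a -> exists2 y, C y & x < y.
  move=> xb; apply: contrapT => nC.
  have : below l #<= [set x].
    apply: lmin; split=> [_ ->//|y yb]; exists x => //.
    have [z Cz yz] := Ccof y yb; apply: le_trans yz _.
    by rewrite leNgt; apply/negP => xz; apply: nC; exists z.
  by move=> /card_le_finite/(_ (finite_set1 x)).
have /card_eqPle[/(card_le_inj_on o)[f fl finj] _] := Cl.
(* [k] inverts the injection [f] of [C] into [l]; indices outside its image get the default [o]. *)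
have /choice[k kP] : forall i, exists y,
    (C y \/ y = o) /\ forall c, C c -> f c = i -> y = c.
  move=> i; have [[c Cc fc]|nc] := pselect (exists2 c, C c & f c = i).
    exists c; split=> [|c' Cc' fc']; first by left.
    by apply: finj => //; rewrite fc.
  by exists o; split=> [|c Cc fc]; [right|exfalso; apply: nc; exists c].
exists k; split=> [i|x xb].
  by have [[/Cb//|->]] := kP i.
have [y Cy xy] := Cn x xb; exists (f y); first exact: fl.
by rewrite ((kP (f y)).2 y Cy erefl).
Qed.

Lemma independent_family : exists f : set K -> K -> K,
  (forall X a, f X a < b a) /\
  forall (X : K -> set K) (g : K -> K),
    (forall i j, i < l -> j < l -> X i = X j -> i = j) ->
    (forall a, g a < b a) -> ~ forall i, i < l -> le_star (f (X i)) g.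
Proof.
have [o _] := inaccessible_point.
pose codes := [set p : K * set (set K * K) |
  p.2 `<=` power_set (below p.1) `*` below l].
have codes_le : codes #<= S.
  apply: card_le_trans (unbounded_card_ge S_cofinal).
  apply: (@fibred_card_le _ _ fst) => c.
  apply: card_le_small (small_power_set (small_setM
    (small_power_set (small_below c)) (small_below l))).
  apply: (@inj_on_card_le _ _ _ _ snd) => [[x G] [/= cG xc]|].
    by move=> p /cG; rewrite /= xc.
  by move=> [x G] [y H] [_ /= ->] [_ /= ->] ->.
have [code codeS code_inj] := card_le_inj_on o codes_le.
have /choice[k kP] : forall a, exists k : K -> K, (forall i, k i < b a) /\
    (S a -> forall x, x < b a -> exists2 i, i < l & x < k i).
  move=> a; have [/exists_cofinal_map[k [kb kP]]|nS] := pselect (S a).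
    by exists k.
  by have [y yb] := b_neq0 a; exists (fun=> y).
(* A code holds an arbitrary relation; it assigns an index to a trace only when that index is
   unique. *)
pose decodes X (p : K * set (set K * K)) i :=
  forall j, p.2 (X `&` below p.1, j) <-> j = i.
(* Injectivity of [code] leaves at most one code attached to a point, so the prescribed value is
   unambiguous. *)
have /choice[f fP] : forall Xa : set K * K, exists y, y < b Xa.2 /\
    forall p i, codes p -> code p = Xa.2 -> decodes Xa.1 p i -> y = k Xa.2 i.
  move=> [X a] /=.
  have [[p [i [cp pa pi]]]|np] :=
      pselect (exists p i, [/\ codes p, code p = a & decodes X p i]).
    exists (k a i); split=> [|q j cq qa qj]; first exact: (kP a).1.
    have pq : p = q by apply: code_inj => //; rewrite pa.
    by congr k; apply/qj; rewrite -pq; apply/pi.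
  exists (k a o); split=> [|q j cq qa qj]; first exact: (kP a).1.
  by exfalso; apply: np; exists q, j.
exists (fun X a => f (X, a)); split=> [X a|X g Xinj gb].
  by have [] := fP (X, a).
move=> dom.
have /choice[beta betaP] : forall i, exists beta, i < l ->
    forall a, beta < a -> f (X i, a) <= g a.
  move=> i; have [/dom[beta bP]|] := pselect (i < l); first by exists beta.
  by exists o.
have [B BP] := small_family_bounded beta (small_below l).
(* Distinct sets have distinct traces beyond any point on which they disagree; [C] below bounds
   these points for all pairs of indices. *)
have /choice[gam gamP] : forall p : K * K, exists c, p.1 < l -> p.2 < l ->
    forall c', c < c' -> X p.1 `&` below c' = X p.2 `&` below c' -> p.1 = p.2.
  move=> [i j] /=.
  have [eqX|neX] := pselect (X i = X j).
    by exists o => il jl _ _ _; exact: Xinj.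
  have [c cP] : exists c, ~ (X i c <-> X j c).
    apply: contrapT => nc; apply: neX; apply/funext => c; apply/propext.
    by apply: contrapT => h; apply: nc; exists c.
  exists c => _ _ c' cc' /seteqP[ij ji]; exfalso; apply: cP; split=> Xc.
    by have [] := ij c (conj Xc cc').
  by have [] := ji c (conj Xc cc').
have [C CP] :=
  small_family_bounded gam (small_setM (small_below l) (small_below l)).
pose G c : K * set (set K * K) :=
  (c, [set q | exists2 i, i < l & q = (X i `&` below c, i)]).
have Gcodes c : codes (G c).
  by move=> _ [i il ->]; split=> //= x [].
(* Otherwise the kappa many [c] above [C] would be mapped injectively below [B]. *)
have [c Cc Bc] : exists2 c, C < c & B <= code (G c).
  apply: contrapT => nB.
  apply: (@not_card_le_below B); apply: card_le_trans (card_le_above C) _.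
  apply: (@inj_on_card_le _ _ _ _ (code \o G)) => [c Cc|c c' _ _ /=].
    by rewrite /below/= ltNge; apply/negP => ?; apply: nB; exists c.
  by move=> /code_inj -/(_ (Gcodes _) (Gcodes _))[].
have Gdec i : i < l -> decodes (X i) (G c) i.
  move=> il j; split=> [[i' i'l [E ->]]|->]; last by exists i.
  apply: (gamP (i', i)) => //=; last exact: esym E.
  by apply: lt_trans Cc; apply: CP.
have Sc := codeS _ (Gcodes c).
(* At the point [code (G c)] the terms [k _ i] are cofinal, so one exceeds the value of [g],
   although this point is past every threshold [beta i]. *)
have [i il gi] := (kP _).2 Sc _ (gb (code (G c))).
have := betaP i il _ (lt_le_trans (BP i il) Bc).
by rewrite ((fP (X i, _)).2 (G c) i) ?leNgt ?gi //; exact: Gdec.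
Qed.

(** * The lower bound for dominating families *)

Lemma dominating_card_ge (D : set (K -> K)) :
  dominating b D -> [set: set K] #<= D.
Proof.
have [o _] := inaccessible_point.
move=> [Db Ddom]; have [f [fb f_indep]] := independent_family.
have [pair _ pair_inj] := card_le_inj_on o card_le_setMKK.
have /choice[g gP] : forall X, exists g, D g /\ le_star (f X) g.
  by move=> X; have [g] := Ddom (f X) (fb X); exists g.
(* By independence [l] does not inject into the sets whose functions [h] dominates; by comparability
   these sets inject into [l]. *)
have /choice[rank rankP] : forall h, exists r : set K -> K, D h ->
    (forall X, le_star (f X) h -> r X < l) /\
    forall X Y, le_star (f X) h -> le_star (f Y) h -> r X = r Y -> X = Y.
  move=> h; have [Dh|] := pselect (D h); last by exists (fun=> o).
  have [|] := card_le_total_below [set X | le_star (f X) h] l.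
    move=> /(card_le_inj_on set0)[X Xh Xinj]; exfalso.
    by apply: (f_indep X h) => // a; exact: Db.
  by move=> /(card_le_inj_on o)[r rl rinj]; exists r.
(* Koenig's argument: [slice i X] is the [i]-th set coded by [X]. *)
pose slice i (X : set K) := [set y | X (pair (i, y))].
pose fibre i := [set X | rank (g X) X = i].
have [i sliceP] : exists i, forall Y, exists2 X, fibre i X & slice i X = Y.
  apply: contrapT => ns.
  have /choice[Y YP] : forall i, exists Y,
      forall X, fibre i X -> slice i X <> Y.
    move=> i; apply: contrapT => nY; apply: ns; exists i => Y.
    apply: contrapT => nX; apply: nY; exists Y => X Xi XY.
    by apply: nX; exists X.
  (* Every slice of [X] is one of the omitted sets [Y i], including the slice at the index of the
     fibre containing [X]. *)
  pose X := [set z | exists2 p, Y p.1 p.2 & z = pair p].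
  apply: (YP (rank (g X) X) X) => //.
  apply/seteqP; split=> y /=; last by exists (rank (g X) X, y).
  by case=> -[i z] /= Yz /pair_inj -/(_ I I)[-> ->].
have /choice[h hP] : forall Y, exists X, fibre i X /\ slice i X = Y.
  by move=> Y; have [X] := sliceP Y; exists X.
(* Within one fibre [g] is injective, since [g X] and the rank determine [X]. *)
apply: (@inj_on_card_le _ _ _ _ (g \o h)) => [Y _|Y Z _ _ /= E].
  exact: (gP _).1.
rewrite -(hP Y).2 -(hP Z).2; congr slice.
have [DY lY] := gP (h Y); have [_ lZ] := gP (h Z).
apply: ((rankP _ DY).2) => //; first by rewrite E.
by rewrite [LHS](hP Y).1 E; symmetry; exact: (hP Z).1.
Qed.

End IndependentFamily.

(** * The upper bound and the conclusion *)

Lemma card_le_functions : [set: K -> K] #<= [set: set K].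
Proof.
have [o _] := inaccessible_point.
have [pair _ pair_inj] := card_le_inj_on o card_le_setMKK.
(* A function is coded by its graph, made a subset of kappa by the pairing. *)
apply: (@inj_on_card_le _ _ _ _
  (fun f => [set z | exists x, z = pair (x, f x)])) => // f g _ _ E.
apply/funext => x.
have : [set z | exists x, z = pair (x, f x)] (pair (x, f x)) by exists x.
by rewrite E => -[y /pair_inj -/(_ I I)[-> ->]].
Qed.

End Inaccessible.

Theorem theorem3p5 (d : Order.disp_t) (K : orderType d) (b : K -> K)
    (lambda : K)
    (hK : inaccessible K)
    (b_incr : {homo b : x y / x <= y})
    (b_card : forall a : K, is_infinite_cardinal (below (b a)))
    (lambda_reg : is_regular (below lambda))
    (b_cf : cofinal_in [set: K]
              [set a | cofinality_is (below (b a)) (below lambda)]) :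
  dominating_number_is b (power_set [set: K]).
Proof.
have -> : power_set [set: K] = [set: set K] by rewrite -subTset => X _ x.
have lower D : dominating b D -> [set: set K] #<= D.
  apply: (dominating_card_ge hK) => [a||x].
  - apply/set0P/negP => /eqP b0; apply: (b_card a).2.
    by rewrite b0; exact: finite_set0.
  - exact: lambda_reg.1.2.
  - exact: b_cf.2.
have prod_dom : dominating b (bounded_prod b).
  (* Each [f] dominates itself past any threshold; [lambda] is an arbitrary choice. *)
  by split=> // f fb; exists f => //; exists lambda.
split=> //; exists (bounded_prod b) => //.
apply/card_eqPle; split; last exact: lower.
exact: card_le_trans (card_leT _) (card_le_functions hK).
Qed.
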